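(* Let $t\mapsto(\mathbf{u}(t),\mathbf{r}(t))\in\mathbb{C}^N\times\mathbb{R}^N$ be a differentiable solution of the semi-discrete system $$\mathbf{u}_t=\mathrm{i}D_1^2\mathbf{u}+\mathrm{i}\beta\,\mathbf{r}\cdot\mathbf{u},\qquad \mathbf{r}_t=\bar{\mathbf{u}}\cdot\mathbf{u}_t+\mathbf{u}\cdot\bar{\mathbf{u}}_t .$$ Then the semi-discrete mass conservation law holds: $$\frac{\mathrm{d}}{\mathrm{d}t}M(\mathbf{u},\mathbf{r})=\frac{\mathrm{d}}{\mathrm{d}t}\|\mathbf{u}\|^2=0 .$$
   Context: $[a,b]$ is an interval of length $L=b-a$, $N$ is an even positive integer, $h=L/N$, $x_j=a+jh$, $\mu=2\pi/L$, and $\beta\in\mathbb{R}$ is a constant. $D_1$ is the real skew-symmetric $N\times N$ Fourier spectral differentiation matrix with entries, for $j,l=0,\dots,N-1$, $(D_1)_{j+1,l+1}=\frac12(-1)^{j+l}\mu\cot\!\big(\mu\frac{x_j-x_l}{2}\big)$ if $j\ne l$ and $(D_1)_{j+1,j+1}=0$. For vectors, $\mathbf{u}\cdot\mathbf{v}$ denotes the componentwise product, $\bar{\mathbf{u}}$ the componentwise complex conjugate, $(\mathbf{u},\mathbf{v})=h\sum_{i=0}^{N-1}u_i\bar v_i$ and $\|\mathbf{u}\|^2=(\mathbf{u},\mathbf{u})$. The discrete mass is $M(\mathbf{u},\mathbf{r})=\|\mathbf{u}\|^2$. *)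

(* Defs.v *)
From HB Require Import structures.
From mathcomp Require Import all_boot all_order all_algebra complex.
From mathcomp Require Import all_classical all_reals all_analysis.

Set Implicit Arguments.
Unset Strict Implicit.
Unset Printing Implicit Defensive.

Import Order.TTheory GRing.Theory Num.Theory.
Import numFieldNormedType.Exports.
Local Open Scope classical_set_scope.
Local Open Scope ring_scope.
Local Open Scope complex_scope.

(* [Rcomplex R] is the alias of R[i] carrying the R-vector space structure and
   the modulus as an R-valued norm.  We complete it to a normed R-module, so
   that the derivative of a function R -> R[i] is the library's one. *)
Lemma Rcomplex_normrZ (R : realType) (l : R) (x : Rcomplex R) : `|l *: x| = `|l| * `|x|.
Proof.
case: x => x y; rewrite /Num.norm /= !exprMn -mulrDr.
by rewrite sqrtrM ?sqr_ge0// sqrtr_sqr.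
Qed.

HB.instance Definition _ (R : realType) :=
  PseudoMetric.copy (Rcomplex R) (pseudoMetric_normed (Rcomplex R)).
HB.instance Definition _ (R : realType) := isPointed.Build (Rcomplex R) 0.
HB.instance Definition _ (R : realType) :=
  NormedZmod_PseudoMetric_eq.Build R (Rcomplex R) erefl.
HB.instance Definition _ (R : realType) :=
  PseudoMetricNormedZmod_Lmodule_isNormedModule.Build R (Rcomplex R)
    (@Rcomplex_normrZ R).

Section VectorDerivative.
Variables (R : realType) (V : normedModType R) (N : nat).

Definition vderivable (w : R -> 'cV[V]_N) (t : R) : Prop :=
  forall j : 'I_N, derivable (fun s => w s j 0) t 1.

Definition vderive (w : R -> 'cV[V]_N) (t : R) : 'cV[V]_N :=
  \col_j derive1 (fun s => w s j 0) t.

End VectorDerivative.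

Section Vectors.
Variables (R : realType) (N : nat).
Implicit Types u v : 'cV[R[i]]_N.

Definition vmul u v : 'cV[R[i]]_N := map2_mx *%R u v.

Definition vconj u : 'cV[R[i]]_N := map_mx (fun z : R[i] => z^*) u.

Definition mxC m n (A : 'M[R]_(m, n)) : 'M[R[i]]_(m, n) :=
  map_mx (real_complex R) A.

End Vectors.

Section Discretization.
Variables (R : realType) (a b : R) (N : nat).

Definition meshsize : R := (b - a) / N%:R.

Definition gridpt (j : nat) : R := a + j%:R * meshsize.

Definition freq : R := 2 * pi / (b - a).

Definition cot (x : R) : R := cos x / sin x.

Definition D1 : 'M[R]_N :=
  \matrix_(j, l)
    if j == l then 0
    else 2^-1 * (-1) ^+ (j + l) * freq
         * cot (freq * ((gridpt j - gridpt l) / 2)).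

Definition dotu (u v : 'cV[R[i]]_N) : R[i] :=
  meshsize%:C * \sum_(j < N) u j 0 * (v j 0)^*.

Definition sqnorm (u : 'cV[R[i]]_N) : R[i] := dotu u u.

(* The mass does not depend on the auxiliary variable r. *)
Definition mass (u : 'cV[R[i]]_N) (r : 'cV[R]_N) : R[i] := sqnorm u.

End Discretization.

(* Main.v *)
Require Import Defs.
From HB Require Import structures.
From mathcomp Require Import all_boot all_order all_algebra complex.
From mathcomp Require Import all_classical all_reals all_analysis.

Import Order.TTheory GRing.Theory Num.Theory.
Import numFieldNormedType.Exports.
Local Open Scope classical_set_scope.
Local Open Scope ring_scope.
Local Open Scope complex_scope.

(** The mass [h * \sum_j |u_j|^2] has derivative
    [2 * Re (h * \sum_j u'_j * conj u_j)] along any differentiable curve.  The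
    equation for [u] has the Schroedinger form [u' = i H u] where
    [H = D1^2 + beta * diag(r)] is, at each instant, a real symmetric matrix:
    [D1] is skew-symmetric, because its cotangent entries are odd in
    [x_j - x_l], so its square is symmetric.  For such an [H] the quadratic form
    [u^* H u] equals its own conjugate, hence is real; so [u^* u'] is purely
    imaginary and the derivative of the mass vanishes.

    Complex curves are differentiated through their real and imaginary parts:
    [Re], [Im] and the embedding of the reals are real-linear contractions, and
    these commute with the derivative ([is_derive_linear_contraction]).  The
    calculus is in [is_derive_sqnorm], the algebra in [hermitian_form_real] and
    [D1_sqr_sym]. *)

(* [Num.Theory] binds these names to the parts that are themselves complex;
   below they are the real-valued projections. *)
Local Notation Re := complex.Re.
Local Notation Im := complex.Im.

(** * Differentiation of the squared norm *)

(** A bounded linear map is continuous, so it passes to the limit of the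
    difference quotients.  A bound by the norm itself is what the three maps
    relating [R] and [Rcomplex R] satisfy. *)
Lemma is_derive_linear_contraction (R : realType) (V W : normedModType R)
    (L : V -> W) (f : R -> V) (t : R) (df : V) :
  linear L -> (forall x, `|L x| <= `|x|) ->
  is_derive t 1 f df -> is_derive t 1 (fun s => L (f s)) (L df).
Proof.
move=> linL contrL [df_ex df_val].
pose LM := GRing.isLinear.Build _ _ _ _ _ linL.
pose LL : {linear V -> W} := HB.pack L LM.
have LLcont : continuous LL.
  apply: bounded_linear_continuous; apply/linear_boundedP.
  near=> k => x; apply: (le_trans (contrL x)).
  by rewrite ler_peMl//; near: k; exact: nbhs_pinfty_ge.
have cvgL : (fun h : R => h^-1 *: (((L \o f) \o shift t) (h *: 1) - (L \o f) t))
    @ 0^' --> L df.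
  (* by linearity, [L] maps the difference quotients of [f] to those of
     [L \o f] *)
  rewrite (_ : (fun h : R => _) = LL \o
      (fun h : R => h^-1 *: ((f \o shift t) (h *: 1) - f t))); last first.
    apply: boolp.funext => h /=.
    by rewrite -[L]/(LL : V -> W) [RHS]linearZ [in RHS]linearB.
  have dqf : (fun h : R => h^-1 *: ((f \o shift t) (h *: 1) - f t)) @ 0^' --> df.
    by rewrite -df_val; exact: df_ex.
  exact: (cvg_comp _ _ dqf (LLcont df)).
by split; [apply/cvg_ex; exists (L df) | exact: cvg_lim].
Unshelve. all: by end_near. Qed.

Lemma Re_contraction (R : realType) (z : Rcomplex R) : `|Re z| <= `|z|.
Proof.
by case: z => x y; rewrite -sqrtr_sqr ler_wsqrtr// lerDl sqr_ge0.
Qed.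

Lemma Im_contraction (R : realType) (z : Rcomplex R) : `|Im z| <= `|z|.
Proof.
by case: z => x y; rewrite -sqrtr_sqr ler_wsqrtr// lerDr sqr_ge0.
Qed.

Lemma real_complex_linear (R : realType) :
  linear (real_complex R : R -> Rcomplex R).
Proof. by move=> k x y; apply/eqP; rewrite eq_complex /= mulr0 addr0 !eqxx. Qed.

Lemma real_complex_contraction (R : realType) (x : R) :
  `|x%:C : Rcomplex R| <= `|x|.
Proof. by rewrite [X in X <= _]/Num.norm /= expr0n addr0 sqrtr_sqr. Qed.

(** Exhibits the squared norm as the embedding of a real function of the real
    coordinates, to which the product rule for real functions applies. *)
Lemma sqnormE (R : realType) (a b : R) (N : nat) (u : 'cV[R[i]]_N) :
  sqnorm a b u =
  (meshsize a b N * \sum_(j < N) ((Re (u j 0)) ^+ 2 + (Im (u j 0)) ^+ 2))%:C.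
Proof.
rewrite /sqnorm /dotu [RHS]rmorphM; congr (_ * _).
rewrite (raddf_sum (real_complex R)).
by apply: eq_bigr => j _; rewrite -sqr_normc -add_Re2_Im2.
Qed.

(** [|z|^2 = Re z ^ 2 + Im z ^ 2] differentiates to
    [2 * (Re z * Re z' + Im z * Im z') = 2 * Re (z' * conj z)]. *)
Lemma is_derive_sqnorm (R : realType) (a b : R) (N : nat)
    (u : R -> 'cV[R[i]]_N) (t : R) :
  vderivable (V := Rcomplex R) u t ->
  is_derive t 1 (fun s => sqnorm a b (u s) : Rcomplex R)
    (2 * Re (dotu a b (vderive (V := Rcomplex R) u t) (u t)))%:C.
Proof.
move=> du.
set u' := vderive _ _.
have duj j : is_derive t 1 (fun s => u s j 0 : Rcomplex R) (u' j 0).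
  by rewrite mxE derive1E; exact: derivableP (du j).
have dRe j : is_derive t 1 (fun s => Re (u s j 0)) (Re (u' j 0)).
  exact: (is_derive_linear_contraction _ _ _ _ _ _ _
    (@Re_is_scalar R) (@Re_contraction R) (duj j)).
have dIm j : is_derive t 1 (fun s => Im (u s j 0)) (Im (u' j 0)).
  exact: (is_derive_linear_contraction _ _ _ _ _ _ _
    (@Im_is_scalar R) (@Im_contraction R) (duj j)).
under eq_fun do rewrite sqnormE.
apply: (is_derive_linear_contraction _ _ _ _ _ _ _
  (@real_complex_linear R) (@real_complex_contraction R)).
pose g j (s : R) : R := (Re (u s j 0)) ^+ 2 + (Im (u s j 0)) ^+ 2.
pose dg j : R :=
  2 * (Re (u t j 0) * Re (u' j 0) + Im (u t j 0) * Im (u' j 0)).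
have dgj j : is_derive t 1 (g j) (dg j).
  have dg2 := is_deriveD (is_deriveX 2 (dRe j)) (is_deriveX 2 (dIm j)).
  apply: is_derive_eq dg2 _.
  by rewrite /dg /= !expr1 -!scalerA mulrDr.
rewrite (_ : (fun s => _) = meshsize a b N \*: (\sum_(j < N) g j)); last first.
  by apply/funext => s; rewrite /= fct_sumE.
apply: is_derive_eq (is_deriveZ _ (is_derive_sum dgj)) _.
have ReZ (x : R) (z : R[i]) : Re (x%:C * z) = x * Re z.
  by case: z => p q; rewrite /= mul0r subr0.
have ReD (z w : R[i]) : Re (z + w) = Re z + Re w by case: z; case: w.
rewrite /dotu ReZ (big_morph _ ReD erefl) mulrCA.
congr (_ * _); rewrite mulr_sumr; apply: eq_bigr => j _; rewrite /dg.
case: (u t j 0) (u' j 0) => p q [p' q'] /=.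
by rewrite mulrN opprK [p * _]mulrC [q * _]mulrC.
Qed.

(** * Symmetry of the discrete Hamiltonian *)

(** The sign [(-1)^(j + l)] is symmetric in [j] and [l], and the cotangent is
    odd. *)
Lemma D1_skew (R : realType) (a b : R) (N : nat) : (D1 a b N)^T = - D1 a b N.
Proof.
apply/matrixP => j l; rewrite !mxE eq_sym; case: eqP => _; first by rewrite oppr0.
rewrite -(opprB (gridpt a b N j)) mulNr mulrN /cot cosN sinN invrN !mulrN.
by rewrite addnC.
Qed.

Lemma D1_sqr_sym (R : realType) (a b : R) (N : nat) :
  (D1 a b N *m D1 a b N)^T = D1 a b N *m D1 a b N.
Proof. by rewrite trmx_mul D1_skew mulNmx mulmxN opprK. Qed.

(** Conjugating [\sum_(j, k) H_jk u_k conj u_j], with [H] real, exchanges [u_k]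
    and [u_j]; by symmetry of [H] this only renames the summation indices. *)
Lemma hermitian_form_real (R : realType) (a b : R) (N : nat) (H : 'M[R]_N)
    (u : 'cV[R[i]]_N) :
  H^T = H -> Im (dotu a b (mxC H *m u) u) = 0.
Proof.
move=> Hsym.
pose X := \sum_(j < N) \sum_(k < N) (H j k)%:C * u k 0 * (u j 0)^*.
have -> : dotu a b (mxC H *m u) u = (meshsize a b N)%:C * X.
  congr (_ * _); apply: eq_bigr => j _; rewrite mxE mulr_suml.
  by apply: eq_bigr => k _; rewrite mxE.
have XJ : X^* = X.
  rewrite rmorph_sum /X exchange_big; apply: eq_bigr => j _.
  rewrite rmorph_sum; apply: eq_bigr => k _.
  rewrite !rmorphM /= oppr0 conjcK -[in RHS]Hsym mxE.
  by rewrite mulrAC.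
case: X XJ => x y [] /eqP; rewrite eq_sym -addr_eq0.
rewrite -mulr2n mulrn_eq0 /= => /eqP ->.
by rewrite /= mulr0 mul0r addr0.
Qed.

(** The infinitesimal form of unitarity of the flow generated by [i H]. *)
Lemma schroedinger_Re0 (R : realType) (a b : R) (N : nat) (H : 'M[R]_N)
    (u : 'cV[R[i]]_N) :
  H^T = H -> Re (dotu a b ('i *: (mxC H *m u)) u) = 0.
Proof.
move=> Hsym.
have -> : dotu a b ('i *: (mxC H *m u)) u = dotu a b (mxC H *m u) u * 'i.
  rewrite /dotu -mulrA mulr_suml; congr (_ * _); apply: eq_bigr => j _.
  by rewrite mxE [RHS]mulrC mulrA.
by rewrite ReiNIm (hermitian_form_real _ _ _ _ _ _ Hsym) oppr0.
Qed.

(** The nonlinear term is multiplication by a real potential, so once [r] is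
    evaluated at a given time it joins the matrix as a diagonal part, and the
    linear lemma above applies. *)
Lemma discrete_hamiltonianE (R : realType) (N : nat) (S : 'M[R]_N) (beta : R)
    (r : 'cV[R]_N) (u : 'cV[R[i]]_N) :
  'i *: (mxC S *m u) + ('i * beta%:C) *: vmul (mxC r) u =
  'i *: (mxC (S + beta *: diag_mx r^T) *m u).
Proof.
rewrite -scalerA -scalerDr; congr (_ *: _).
rewrite /mxC map_mxD mulmxDl map_mxZ -scalemxAl map_diag_mx mul_diag_mx.
by congr (_ + _ *: _); apply/matrixP => j l; rewrite !mxE [l]ord1.
Qed.

(** * Mass conservation *)

Theorem theorem3p4 (R : realType) (a b : R) (hab : a < b)
    (N : nat) (hN : (0 < N)%N) (hNeven : ~~ odd N) (beta : R)
    (J : set R) (hJopen : open J) (hJitv : is_interval J)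
    (u : R -> 'cV[R[i]]_N) (r : R -> 'cV[R]_N)
    (hu : forall t, J t -> vderivable (V := Rcomplex R) u t)
    (hr : forall t, J t -> vderivable r t)
    (equ : forall t, J t ->
      vderive (V := Rcomplex R) u t
      = 'i *: (mxC (D1 a b N *m D1 a b N) *m u t)
        + ('i * beta%:C) *: vmul (mxC (r t)) (u t))
    (eqr : forall t, J t ->
      mxC (vderive r t)
      = vmul (vconj (u t)) (vderive (V := Rcomplex R) u t)
        + vmul (u t) (vconj (vderive (V := Rcomplex R) u t))) :
  forall t, J t ->
    [/\ derivable (fun s => mass a b (u s) (r s) : Rcomplex R) t 1,
        derive1 (fun s => mass a b (u s) (r s) : Rcomplex R) t
        = derive1 (fun s => sqnorm a b (u s) : Rcomplex R) t
      & derive1 (fun s => sqnorm a b (u s) : Rcomplex R) t = 0].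
Proof.
move=> t Jt.
have dM := is_derive_sqnorm R a b N u t (hu t Jt).
have H_sym : (D1 a b N *m D1 a b N + beta *: diag_mx (r t)^T)^T =
             D1 a b N *m D1 a b N + beta *: diag_mx (r t)^T.
  by rewrite linearD linearZ /= D1_sqr_sym tr_diag_mx.
split=> //.
rewrite derive1E (@derive_val _ _ _ _ _ _ _ dM) equ// discrete_hamiltonianE.
by rewrite schroedinger_Re0// mulr0.
Qed.
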